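(* For non-negative integers $a,b,c,d$, $$\sum_{k=0}^a k\binom{a+b}{a+k}\binom{b+c}{b+k}\binom{c+d}{c+k}\binom{d+a}{d+k}=\frac{b\,Q_{b,c}Q_{c,d}Q_{b+c+d,a}}{2\,Q_{a,c}}\sum_{j=0}^{a-1}\frac{Q_{b,j}\,Q_{c-1,j+1}\,Q_{d-1,j+1}}{Q_{b+c+d,j+1}}.$$
   Context: For integers $x,y$, $Q_{x,y}:=\binom{x+y}{x}$. Convention: an empty sum equals $0$, and $\binom{N}{k}=0$ whenever $k<0$ or $k>N$ (so e.g. $Q_{-1,y}=\binom{y-1}{-1}=0$). *)

(* Defs.v *)
From mathcomp Require Import all_boot all_order all_algebra.

Set Implicit Arguments.
Unset Strict Implicit.
Unset Printing Implicit Defensive.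

Import Order.TTheory GRing.Theory Num.Theory.

Local Open Scope ring_scope.

(* Vanishes for k < 0 and for k > N, the latter by the library convention
   'C(n, m) = 0 for m > n; for N < 0 one of these two cases always holds. *)
Definition binz (N k : int) : nat :=
  match N, k with
  | Posz n, Posz m => 'C(n, m)
  | _, _ => 0%N
  end.

Definition Q (x y : int) : nat := binz (x + y) x.

(* Main.v *)
(** Creative telescoping in [a].  Write [S a] for the left-hand sum, [a' = a + 1],
    [B k] for the product of the four binomials at [a'], and [e1], [e3] for the
    elementary symmetric functions of [a', b, c, d].  Since
      [prod_x (x + k) - prod_x (x - k) = 2 k (e3 + e1 k^2)]
    over [x] in [a', b, c, d], the sequence
      [G k = B k (a' + k) (b + k) (c + k) (d + k)]
    satisfies [G k - G (k+1) = 2 k (e3 + e1 k^2) B k], and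
      [(a' + b) (a' + c) (a' + d) - e1 (a'^2 - k^2) = e3 + e1 k^2]
    turns the telescoped sum into a first-order recurrence
      [2 (a'+b) (a'+c) (a'+d) S a' - 2 e1 (a'+b) (a'+d) S a = G 0],
    which the right-hand side satisfies as well. *)
Require Import Defs.
From mathcomp Require Import all_boot all_order all_algebra.
From mathcomp Require Import ring.

Set Implicit Arguments.
Unset Strict Implicit.
Unset Printing Implicit Defensive.

Import Order.TTheory GRing.Theory Num.Theory.

Local Open Scope ring_scope.

(** The difference [n - k] is taken in the ring, so no bound on [k] is needed: for [k > n] both
    binomials vanish. *)
Lemma binS_ring (R : comPzRingType) (m n k : nat) :
  'C(m + n, (m + k).+1)%:R * (m%:R + k%:R + 1)
  = 'C(m + n, m + k)%:R * (n%:R - k%:R) :> R.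
Proof.
have := congr1 (fun x => x%:R : R) (mul_bin_left (m + n) (m + k)).
rewrite subnDl !natrM -(natr1 (m + k)) natrD => E.
rewrite mulrC E mulrC; have [le_kn|lt_nk] := leqP k n.
  by rewrite natrB.
by rewrite bin_small ?ltn_add2l // !mul0r.
Qed.

Lemma binSS_ring (R : comPzRingType) (n m : nat) :
  'C(n, m)%:R * (n%:R + 1) = 'C(n.+1, m.+1)%:R * (m%:R + 1) :> R.
Proof. by rewrite !natr1 -!natrM mulnC mul_bin_diag mulnC. Qed.

Lemma bin_pred_ring (R : comPzRingType) (m n k : nat) :
  'C(m + n, m + k)%:R * (m%:R + n%:R + 1)
  = 'C(m + n.+1, m + k)%:R * (n%:R + 1 - k%:R) :> R.
Proof.
have := congr1 (fun x => x%:R : R) (mul_bin_down (m + n.+1) (m + k)).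
rewrite subnDl addnS /= !natrM -natr1 natrD mulrC => ->.
rewrite mulrC; have [le_kn|lt_nk] := leqP k n.+1.
  by rewrite natrB // -natr1.
by rewrite bin_small ?mul0r // -addnS ltn_add2l.
Qed.

Lemma binDC (m n : nat) : 'C(m + n, m) = 'C(n + m, n).
Proof. by rewrite -[LHS]bin_sub ?leq_addr // addKn addnC. Qed.

Lemma Q_nat (x y : nat) : Q x%:Z y%:Z = 'C(x + y, x).
Proof. by []. Qed.

(** Absorption, in cross-multiplied form to cover [c = 0], where the lower index [-1] makes [Q]
    vanish. *)
Lemma Q_pred (c y : nat) :
  (Q (c%:Z - 1) y%:Z * (c + y) = c * 'C(c + y, c))%N.
Proof.
case: c => [|c]; first by rewrite /Q /binz; case: (_ + _).
have ->: c.+1%:Z - 1 = c%:Z by rewrite -addn1 PoszD addrK.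
by rewrite Q_nat addSn -mul_bin_diag mulnC.
Qed.

Definition binprod (a b c d k : nat) : nat :=
  ('C(a + b, a + k) * 'C(b + c, b + k) * 'C(c + d, c + k) * 'C(d + a, d + k))%N.

Definition wsum (a b c d : nat) : rat :=
  \sum_(0 <= k < a.+1) k%:R * (binprod a b c d k)%:R.

Lemma binprodS (a b c d k : nat) :
  (binprod a b c d k.+1)%:R * (a%:R + k%:R + 1) * (b%:R + k%:R + 1)
     * (c%:R + k%:R + 1) * (d%:R + k%:R + 1)
  = (binprod a b c d k)%:R * (a%:R - k%:R) * (b%:R - k%:R)
     * (c%:R - k%:R) * (d%:R - k%:R) :> rat.
Proof.
rewrite /binprod !natrM !addnS.
transitivity (('C(a + b, (a + k).+1)%:R * (a%:R + k%:R + 1))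
  * ('C(b + c, (b + k).+1)%:R * (b%:R + k%:R + 1))
  * ('C(c + d, (c + k).+1)%:R * (c%:R + k%:R + 1))
  * ('C(d + a, (d + k).+1)%:R * (d%:R + k%:R + 1)) : rat); first by ring.
by rewrite !binS_ring; ring.
Qed.

(** Only two binomials involve [a]. Raising [a] shifts both indices of the first, giving
    [a + 1 + k], but only the upper index of the second, giving [a + 1 - k]. *)
Lemma binprod_pred (a b c d k : nat) :
  (binprod a b c d k)%:R * (a%:R + b%:R + 1) * (a%:R + d%:R + 1)
  = (binprod a.+1 b c d k)%:R * ((a%:R + 1) ^+ 2 - k%:R ^+ 2) :> rat.
Proof.
rewrite /binprod !natrM.
transitivity ('C(b + c, b + k)%:R * 'C(c + d, c + k)%:R
  * ('C(a + b, a + k)%:R * ((a + b)%:R + 1))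
  * ('C(d + a, d + k)%:R * (d%:R + a%:R + 1)) : rat); first by rewrite natrD; ring.
by rewrite binSS_ring bin_pred_ring !addSn natrD; ring.
Qed.

Lemma wsum_recl (a b c d : nat) :
  2 * (a%:R + b%:R + 1) * (a%:R + c%:R + 1) * (a%:R + d%:R + 1) * wsum a.+1 b c d
  - 2 * (a%:R + b%:R + c%:R + d%:R + 1) * (a%:R + b%:R + 1) * (a%:R + d%:R + 1)
    * wsum a b c d
  = (a%:R + 1) * b%:R * c%:R * d%:R * (binprod a.+1 b c d 0)%:R.
Proof.
(* Both sums get the same range; the added term [k = a + 1] vanishes. *)
have ->: wsum a b c d = \sum_(0 <= k < a.+2) k%:R * (binprod a b c d k)%:R.
  rewrite [RHS]big_nat_recr //= /binprod (@bin_small (d + a)) ?muln0 ?mulr0 ?addr0 //.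
  by rewrite addnS.
pose G k : rat := (binprod a.+1 b c d k)%:R * (a%:R + 1 + k%:R) * (b%:R + k%:R)
  * (c%:R + k%:R) * (d%:R + k%:R).
transitivity (G 0%N); last by rewrite /G; ring.
have G_last : G a.+2 = 0.
  by rewrite /G /binprod (@bin_small (d + a.+1)) ?muln0 ?mul0r // ltn_add2l.
have -> : G 0%N = - G a.+2 - (- G 0%N) by rewrite G_last oppr0 add0r opprK.
rewrite -(telescope_sumr (fun k => - G k)) // /wsum !mulr_sumr -sumrB.
apply: eq_bigr => k _.
have GS : G k.+1 = (binprod a.+1 b c d k)%:R * (a%:R + 1 - k%:R) * (b%:R - k%:R)
    * (c%:R - k%:R) * (d%:R - k%:R).
  by have := binprodS a.+1 b c d k; rewrite /G -(natr1 a) -(natr1 k) !addrA.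
rewrite GS /G.
transitivity (2 * (a%:R + b%:R + 1) * (a%:R + c%:R + 1) * (a%:R + d%:R + 1)
    * (k%:R * (binprod a.+1 b c d k)%:R)
  - 2 * (a%:R + b%:R + c%:R + d%:R + 1) * k%:R
    * ((binprod a b c d k)%:R * (a%:R + b%:R + 1) * (a%:R + d%:R + 1)) : rat).
  by ring.
by rewrite binprod_pred; ring.
Qed.

Definition closed_form (a b c d : nat) : rat :=
  (b%:R * (Q b%:Z c%:Z)%:R * (Q c%:Z d%:Z)%:R
       * (Q (b%:Z + c%:Z + d%:Z) a%:Z)%:R) / (2%:R * (Q a%:Z c%:Z)%:R)
    * \sum_(0 <= j < a)
        ((Q b%:Z j%:Z)%:R * (Q (c%:Z - 1) (j%:Z + 1))%:R
           * (Q (d%:Z - 1) (j%:Z + 1))%:R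
         / (Q (b%:Z + c%:Z + d%:Z) (j%:Z + 1))%:R).

Lemma natr_bin_neq0 (m n : nat) : ('C(m + n, m))%:R != 0 :> rat.
Proof. by rewrite pnatr_eq0 -lt0n bin_gt0 leq_addr. Qed.

(** The prefactors at [a + 1] and [a] have ratio [(a + b + c + d + 1) / (a + c + 1)], so the common
    sum [T] cancels and only the new summand [j = a] remains. *)
Lemma closed_form_recl (a b c d : nat) :
  2 * (a%:R + b%:R + 1) * (a%:R + c%:R + 1) * (a%:R + d%:R + 1)
    * closed_form a.+1 b c d
  - 2 * (a%:R + b%:R + c%:R + d%:R + 1) * (a%:R + b%:R + 1) * (a%:R + d%:R + 1)
    * closed_form a b c d
  = (a%:R + 1) * b%:R * c%:R * d%:R * (binprod a.+1 b c d 0)%:R.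
Proof.
rewrite /closed_form big_nat_recr //= -!PoszD !Q_nat.
set T := \sum_(0 <= _ < a) _.
rewrite !addn1.
have nat1_neq0 n : n%:R + 1 != 0 :> rat by rewrite natr1 pnatr_eq0.
have Qp x : (Q (x%:Z - 1) a.+1%:Z)%:R
    = x%:R * ('C(x + a.+1, x))%:R / (x%:R + a%:R + 1) :> rat.
  have nz : x%:R + a%:R + 1 != 0 :> rat by rewrite -natrD nat1_neq0.
  apply: (canRL (mulfK nz)).
  by rewrite -natrD natr1 -addnS -!natrM Q_pred.
have bin_step m : ('C(m + a.+1, m))%:R
    = ('C(m + a, m))%:R * (m%:R + a%:R + 1) / (a%:R + 1) :> rat.
  apply: (canRL (mulfK (nat1_neq0 a))).
  by have := bin_pred_ring rat m a 0; rewrite !addn0 subr0.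
(* Symmetry brings the binomials into the shape that [bin_step] expects. *)
rewrite !Qp /binprod !addn0 !natrM (binDC a.+1 c) (binDC a.+1 b) (binDC a c).
rewrite (bin_step (b + c + d)%N) (bin_step b) (bin_step c) !natrD.
have nz0 := nat1_neq0 a.
have nz x : x%:R + a%:R + 1 != 0 :> rat by rewrite -natrD nat1_neq0.
have nze := nz (b + c + d)%N; rewrite !natrD in nze.
have nzc := nz c; have nzd := nz d.
have nzCe := natr_bin_neq0 (b + c + d) a; have nzCc := natr_bin_neq0 c a.
by field; rewrite nz0 nze nzc nzd nzCe nzCc.
Qed.

Theorem theorem2p9 (a b c d : nat) :
  \sum_(0 <= k < a.+1)
     (k%:R * ('C(a + b, a + k))%:R * ('C(b + c, b + k))%:R
           * ('C(c + d, c + k))%:R * ('C(d + a, d + k))%:R)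
  = (b%:R * (Q b%:Z c%:Z)%:R * (Q c%:Z d%:Z)%:R
       * (Q (b%:Z + c%:Z + d%:Z) a%:Z)%:R) / (2%:R * (Q a%:Z c%:Z)%:R)
    * \sum_(0 <= j < a)
        ((Q b%:Z j%:Z)%:R * (Q (c%:Z - 1) (j%:Z + 1))%:R
           * (Q (d%:Z - 1) (j%:Z + 1))%:R
         / (Q (b%:Z + c%:Z + d%:Z) (j%:Z + 1))%:R)
  :> rat.
Proof.
rewrite -/(closed_form a b c d).
transitivity (wsum a b c d).
  by apply: eq_bigr => k _; rewrite /binprod !natrM !mulrA.
elim: a => [|a IHa].
  by rewrite /wsum /closed_form big_nat1 big_geq // mul0r mulr0.
have nz x : a%:R + x%:R + 1 != 0 :> rat by rewrite -natrD natr1 pnatr_eq0.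
have := closed_form_recl a b c d.
(* Both recurrences have the same right-hand side, and the coefficient of the value at [a + 1] is
   nonzero. *)
rewrite -wsum_recl IHa => /addIr /mulfI -> //.
by rewrite !mulf_neq0.
Qed.
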